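(* Let $K$ be a number field of degree $n$, and assume that for every prime number $p$ dividing $n$, $p^2$ does not divide the discriminant $d_K$. Then the trace map $\mathrm{Tr}:\mathcal{O}_K\to\mathbb{Z}$ is surjective.
   Context: $\mathcal{O}_K$ denotes the ring of integers of $K$, a free abelian group of rank $n$. For $\beta\in K$, $\mathrm{Tr}(\beta)=\sum_{i=1}^n\sigma_i(\beta)$, where $\sigma_1,\dots,\sigma_n$ are the embeddings $K\to\mathbb{C}$; it maps $\mathcal{O}_K$ into $\mathbb{Z}$. The discriminant is $d_K=\det(\mathrm{Tr}(\alpha_i\alpha_j))_{i,j=1}^n=(\det(\sigma_i(\alpha_j))_{i,j})^2$ for any $\mathbb{Z}$-basis $\alpha_1,\dots,\alpha_n$ of $\mathcal{O}_K$. *)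

(* Defs.v *)
From mathcomp Require Import all_boot all_order all_algebra all_field.
From mathcomp Require Import boolp classical_sets fsbigop reals complex.

Set Implicit Arguments.
Unset Strict Implicit.
Unset Printing Implicit Defensive.

Import Order.TTheory GRing.Theory Num.Theory.

Local Open Scope classical_set_scope.
Local Open Scope complex_scope.
Local Open Scope ring_scope.

(* A number field is a [fieldExtType rat]; its degree is [\dim {:K}]. *)

Definition ring_of_integers (K : fieldExtType rat) : set K :=
  [set x | integralOver (intr : int -> K) x].

Arguments ring_of_integers K : clear implicits.

(* The embeddings are taken as plain functions, so that two ring morphisms
   with the same values are counted once in [trace]. *)
Definition embeddings (R : realType) (K : fieldExtType rat) :
    set (K -> R[i]) :=
  [set s | exists f : {rmorphism K -> R[i]}, s = f :> (K -> R[i])].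

Arguments embeddings R K : clear implicits.

(* [\sum_(s \in A)] is the sum over the s in A giving a nonzero term, and is 0
   by convention if there are infinitely many; there are only \dim {:K}
   embeddings, so the convention plays no role. *)
Definition trace (R : realType) (K : fieldExtType rat) (x : K) : R[i] :=
  \sum_(s \in embeddings R K) s x.

Definition integral_basis (K : fieldExtType rat) (n : nat)
    (a : 'I_n -> K) : Prop :=
  (forall i, ring_of_integers K (a i)) /\
  (forall x, ring_of_integers K x ->
     exists! c : {ffun 'I_n -> int}, x = \sum_(i < n) a i *~ c i).

Definition trace_matrix (R : realType) (K : fieldExtType rat) (n : nat)
    (a : 'I_n -> K) : 'M[R[i]]_n :=
  \matrix_(i, j) trace R (a i * a j).

(* The integer det (Tr (a_i a_j)), for an integral basis a; as it exists and is
   the same for all a, the default value 0 of [xget] is never taken. *)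
Definition discriminant (R : realType) (K : fieldExtType rat) : int :=
  xget 0 [set d : int | exists a : 'I_(\dim {:K}) -> K,
    integral_basis a /\ d%:~R = \det (trace_matrix R a)].

(* Main.v *)
(** The traces of integers form an ideal dZ of Z, and d divides Tr(1) = n.  A
    prime p dividing d therefore divides n, so that n >= 2, and it divides
    every entry of the n x n matrix (Tr(a_i a_j)), a an integral basis; hence
    p^n, and a fortiori p^2, divides d_K.

    That O_K has an integral basis need not be proved: without one
    [discriminant] would be 0, which the hypothesis excludes when n >= 2. *)

Require Import Defs.
From HB Require Import structures.
From mathcomp Require Import all_boot all_order all_algebra all_field.
From mathcomp Require Import boolp classical_sets fsbigop reals complex.

Set Implicit Arguments.
Unset Strict Implicit.
Unset Printing Implicit Defensive.

Import Order.TTheory GRing.Theory Num.Theory.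

Local Open Scope ring_scope.

(** * Field embeddings and roots of minimal polynomials *)

Local Notation "p ^%:A" := (map_poly (GRing.in_alg _) p) (at level 2).

(** In characteristic 0 every element is separable, so the primitive element theorem applies; [p] is
    the minimal polynomial of [z], taken back from the subfield [1%AS] to [F]. *)
Lemma primitive_generator (F : fieldType) (L : fieldExtType F) :
    has_pchar0 F ->
  exists (z : L) (p : {poly F}),
    [/\ size p = (\dim {:L}).+1, separable_poly p,
        forall q : {poly F}, (q^%:A.[z] == 0) = (p %| q)
      & forall x : L, exists q : {poly F}, x = q^%:A.[z]].
Proof.
move=> char0; have charL : has_pchar0 L by move=> i; rewrite pchar_lalg char0.
pose z := separable_generator 1%AS {:L}%AS.
have sepz : separable_element 1%AS z := pcharf0_separable _ charL z.
have zE : {:L}%VS = <<1; z>>%VS.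
  apply: eq_adjoin_separable_generator; last exact: subvf.
  by apply/separableP => y _; apply: pcharf0_separable.
have /polyOver1P [p pE] := minPolyOver 1%AS z.
exists z, p; split.
- rewrite -(size_map_poly (GRing.in_alg L)) -pE size_minPoly; congr _.+1.
  by rewrite adjoin_degreeE -zE dimv1 divn1.
- by rewrite -(separable_map (GRing.in_alg L)) -pE.
- move=> q; rewrite -(dvdp_map (GRing.in_alg L)) -pE.
  apply/idP/idP => [qz0|/dvdpP [q' ->]].
    by rewrite minPoly_dvdp // -?topredE /= ?qz0 //; apply/polyOver1P; exists q.
  by rewrite hornerM (rootP (root_minPoly _ _)) mulr0.
move=> x; have xz : x \in <<1; z>>%VS by rewrite -zE memvf.
have /polyOver1P [q qE] := Fadjoin_polyOver 1%AS z x.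
by exists q; rewrite -qE Fadjoin_poly_eq.
Qed.

Lemma rmorph_horner_alg (F : fieldType) (L : fieldExtType F) (E : nzRingType)
    (f : {rmorphism L -> E}) (iota : {rmorphism F -> E}) :
    (forall a, f a%:A = iota a) ->
  forall (q : {poly F}) z, f q^%:A.[z] = (map_poly iota q).[f z].
Proof.
move=> fA q z; rewrite -horner_map -map_poly_comp; congr (_.[_]).
by apply: eq_map_poly => a /=; rewrite fA.
Qed.

(* Sending [q(z)] to [q(w)] is well defined because [p] divides every [q]
   vanishing at [z]. *)
Lemma lift_root_to_rmorphism (F : fieldType) (L : fieldExtType F)
    (E : fieldType) (iota : {rmorphism F -> E}) (z : L) (p : {poly F}) (w : E) :
    (forall q : {poly F}, q^%:A.[z] = 0 -> p %| q) ->
    (forall x : L, exists q : {poly F}, x = q^%:A.[z]) ->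
    root (map_poly iota p) w ->
  exists f : {rmorphism L -> E}, f z = w.
Proof.
move=> pmin zgen pw0; have [Q QE] := choice zgen.
pose f x := (map_poly iota (Q x)).[w].
have fE q : f q^%:A.[z] = (map_poly iota q).[w].
  apply/eqP; rewrite -subr_eq0 /f -hornerN -hornerD -rmorphB /=.
  have /dvdpP [r ->] : p %| Q q^%:A.[z] - q.
    by apply: pmin; rewrite rmorphB hornerD hornerN /= -QE subrr.
  by rewrite rmorphM hornerM /= (rootP pw0) mulr0.
have fB : zmod_morphism f.
  move=> x y; rewrite {1}(QE x) {1}(QE y) -hornerN -hornerD -rmorphB fE.
  by rewrite rmorphB hornerD hornerN.
have fM : monoid_morphism f.
  split=> [|x y].
    have <- : (1 : {poly F})^%:A.[z] = 1 by rewrite rmorph1 hornerC.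
    by rewrite fE rmorph1 hornerC.
  by rewrite {1}(QE x) {1}(QE y) -hornerM -rmorphM fE rmorphM hornerM.
pose f' : {rmorphism L -> E} := HB.pack f (GRing.isZmodMorphism.Build _ _ f fB)
   (GRing.isMonoidMorphism.Build _ _ f fM).
exists f'; rewrite /f' /=.
by rewrite -[z in LHS]hornerX -(map_polyX (GRing.in_alg L)) fE map_polyX hornerX.
Qed.

(** By separability, the minimal polynomial [p] of a generator [z] has exactly [\dim {:K}] distinct
    roots in the algebraically closed field [R[i]]. Each root is the image of [z] under an
    embedding, and this image determines the embedding. *)
Lemma embeddings_enum (R : realType) (K : fieldExtType rat) :
  exists s : 'I_(\dim {:K}) -> {rmorphism K -> R[i]},
    injective (fun i => s i : K -> R[i]) /\
    embeddings R K = range (fun i => s i : K -> R[i]).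
Proof.
have [z [p [sizep sepp pz zgen]]] := primitive_generator K (pchar_num _).
set pC : {poly R[i]} := map_poly ratr p.
have [rs pCE] := closed_field_poly_normal pC.
have pC_neq0 : lead_coef pC != 0.
  by rewrite lead_coef_eq0 map_poly_eq0 -size_poly_eq0 sizep.
have size_rs : size rs = \dim {:K}.
  apply: succn_inj; rewrite -sizep.
  rewrite -(size_map_poly (ratr : {rmorphism rat -> R[i]})).
  by rewrite -/pC pCE size_scale // size_prod_XsubC.
have root_rs w : root pC w = (w \in rs).
  by rewrite pCE rootZ // root_prod_XsubC.
have uniq_rs : uniq rs.
  rewrite -separable_prod_XsubC -(eqp_separable (eqp_scale _ pC_neq0)) -pCE.
  by rewrite separable_map.
have /choice [s sE] (i : 'I_(\dim {:K})) :
    exists f : {rmorphism K -> R[i]}, f z = rs`_i.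
  apply: (@lift_root_to_rmorphism _ _ _ ratr z p) => //.
    by move=> q /eqP; rewrite pz.
  by rewrite [root _ _]root_rs mem_nth // size_rs.
(* A ring morphism from [rat] to [R[i]] is unique, so all embeddings agree on the rationals. *)
have fA (f : {rmorphism K -> R[i]}) a : f a%:A = ratr a.
  exact: (fmorph_eq_rat (f \o GRing.in_alg K)).
exists s; split.
  move=> i j /(congr1 (fun f => f z)); rewrite !sE => /eqP.
  by rewrite nth_uniq ?size_rs // => /eqP/val_inj.
apply/seteqP; split=> [_ [f ->]|_ [i _ <-]]; last by exists (s i).
have : f z \in rs.
  rewrite -root_rs /root -(rmorph_horner_alg (fA f)).
  by move: (pz p); rewrite dvdpp => /eqP ->; rewrite rmorph0.
move=> /(nthP 0) [k]; rewrite size_rs => k_lt fz.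
exists (Ordinal k_lt) => //; apply/funext => x.
have [q ->] := zgen x.
by rewrite !(rmorph_horner_alg (fA _)) sE fz.
Qed.

(** Trades the sum over a set of functions for an indexed sum of morphisms, to which the usual big
    operator lemmas apply. *)
Lemma trace_sum_embeddings (R : realType) (K : fieldExtType rat) :
  exists s : 'I_(\dim {:K}) -> {rmorphism K -> R[i]},
    forall x, trace R x = \sum_i s i x.
Proof.
have [s [s_inj embE]] := embeddings_enum R K.
(* As [s] is injective, [r] lists each embedding once. *)
exists s => x; pose r := [seq s i : K -> R[i] | i <- enum 'I_(\dim {:K})].
have -> : trace R x = \sum_(t \in [set` r]) t x.
  rewrite /trace embE; apply: eq_fsbigl; apply/seteqP; split.
    by move=> _ [i _ <-] /=; rewrite map_f // mem_enum.
  by move=> _ /= /mapP [i _ ->]; exists i.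
rewrite -fsbig_seq; first by rewrite big_map big_enum.
by rewrite (map_inj_uniq s_inj) enum_uniq.
Qed.

(** * Linearity and integrality of the trace *)

Lemma traceD (R : realType) (K : fieldExtType rat) (x y : K) :
  trace R (x + y) = trace R x + trace R y.
Proof.
have [s sE] := trace_sum_embeddings R K.
by rewrite !sE -big_split; apply: eq_bigr => i _; rewrite rmorphD.
Qed.

Lemma traceMz (R : realType) (K : fieldExtType rat) (x : K) (c : int) :
  trace R (x *~ c) = trace R x *~ c.
Proof.
have [s sE] := trace_sum_embeddings R K.
rewrite !sE -[RHS]mulrzr mulr_suml; apply: eq_bigr => i _.
by rewrite rmorphMz mulrzr.
Qed.

Lemma trace1 (R : realType) (K : fieldExtType rat) :
  trace R (1 : K) = (\dim {:K})%:R.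
Proof.
have [s ->] := trace_sum_embeddings R K.
rewrite (eq_bigr (fun=> 1)) => [|i _]; last by rewrite rmorph1.
by rewrite sumr_const card_ord.
Qed.

(* With [S = (s_i(a_j))] one has [S^T S = (Tr(a_i a_j))], so [S] is invertible,
   and it conjugates [diag(s_i(x))] into the integer matrix of multiplication
   by [x] in the basis [a]. *)
Lemma trace_int (R : realType) (K : fieldExtType rat)
    (a : 'I_(\dim {:K}) -> K) (x : K) :
    integral_basis a -> \det (trace_matrix R a) != 0 ->
  ring_of_integers K x -> exists t : int, trace R x = t%:~R.
Proof.
move=> [a_int a_basis] det_neq0 x_int.
have [s sE] := trace_sum_embeddings R K.
pose S := \matrix_(i, j) s i (a j).
have trS : trace_matrix R a = S^T *m S.
  apply/matrixP => i j; rewrite !mxE sE; apply: eq_bigr => k _.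
  by rewrite !mxE rmorphM.
have S_unit : S \in unitmx.
  rewrite unitmxE unitfE; apply: contraNneq det_neq0 => S0.
  by rewrite trS det_mulmx S0 mulr0.
have /choice [c cE] j :
    exists c : {ffun 'I_(\dim {:K}) -> int}, x * a j = \sum_k a k *~ c k.
  by have [c []] := a_basis _ (integral_mul x_int (a_int j)); exists c.
pose M := \matrix_(k, j) c j k.
have SM : diag_mx (\row_i s i x) *m S = S *m map_mx intr M.
  apply/matrixP => i j; rewrite mul_diag_mx !mxE -rmorphM cE rmorph_sum.
  by apply: eq_bigr => k _; rewrite !mxE rmorphMz mulrzr.
exists (\tr M); rewrite -trace_map_mx -[map_mx _ _](mulKmx S_unit) -SM.
rewrite mxtrace_mulC mulmxK // mxtrace_diag sE.
by apply: eq_bigr => i _; rewrite mxE.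
Qed.

(** * Divisibility of the discriminant and the ideal of traces *)

Lemma dvdz_det (n : nat) (d : int) (A : 'M[int]_n) :
  (forall i j, (d %| A i j)%Z) -> (d ^+ n %| \det A)%Z.
Proof.
move=> dA; have -> : A = d *: \matrix_(i, j) (A i j %/ d)%Z.
  by apply/matrixP => i j; rewrite !mxE mulrC divzK.
by rewrite detZ dvdz_mulr.
Qed.

Lemma ring_of_integers_int (K : fieldExtType rat) (c : int) :
  ring_of_integers K c%:~R.
Proof. exact: integral_id. Qed.

Lemma ring_of_integersMz (K : fieldExtType rat) (x : K) (c : int) :
  ring_of_integers K x -> ring_of_integers K (x *~ c).
Proof.
by rewrite -mulrzr => x_int; apply: integral_mul => //; apply: integral_id.
Qed.

(** A nonzero value is not the default of [xget], so it comes from an actual basis. *)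
Lemma discriminant_neq0_basis (R : realType) (K : fieldExtType rat) :
    discriminant R K != 0 ->
  exists a : 'I_(\dim {:K}) -> K,
    integral_basis a /\ (discriminant R K)%:~R = \det (trace_matrix R a).
Proof. by rewrite /discriminant; case: xgetP => //; rewrite eqxx. Qed.

Lemma dvdz_discriminant (R : realType) (K : fieldExtType rat) (p : int) :
    discriminant R K != 0 ->
    (forall x, ring_of_integers K x ->
       exists t : int, trace R x = (p * t)%:~R) ->
  (p ^+ \dim {:K} %| discriminant R K)%Z.
Proof.
move=> /discriminant_neq0_basis [a [[a_int _] dE]] p_trace.
(* The sigma type gives a chosen quotient for each pair, from which an integer matrix can be
   formed. *)
have trE i j : {t : int | trace R (a i * a j) = (p * t)%:~R}.
  by apply: cid; apply: p_trace; apply: integral_mul; apply: a_int.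
have -> : discriminant R K = \det (\matrix_(i, j) (p * sval (trE i j))).
  apply: (@intr_inj R[i]); rewrite dE -det_map_mx; congr (\det _).
  by apply/matrixP => i j; rewrite !mxE; apply: svalP (trE i j).
by apply: dvdz_det => i j; rewrite mxE dvdz_mulr.
Qed.

(** Euclidean division: [d] is the least positive integer that is the trace of an integral element;
    the remainder of any trace modulo [d] is again such a trace, hence 0. *)
Lemma trace_generator (R : realType) (K : fieldExtType rat) :
    (forall x, ring_of_integers K x -> exists t : int, trace R x = t%:~R) ->
  exists (d : nat) (x : K),
    [/\ (0 < d)%N, ring_of_integers K x, trace R x = d%:R &
      forall y, ring_of_integers K y ->
        exists t : int, trace R y = (d%:Z * t)%:~R].
Proof.
move=> trZ; pose P (d : nat) := `[< (0 < d)%N /\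
  exists x : K, ring_of_integers K x /\ trace R x = d%:R >].
have exP : exists d, P d.
  exists (\dim {:K}); apply/asboolP; split; first exact: adim_gt0.
  by exists 1; split; [exact: (ring_of_integers_int K 1)|exact: trace1].
case: (ex_minnP exP) => d /asboolP [d_gt0 [x [x_int xd]]] d_min.
exists d, x; split=> // y y_int; have [t tE] := trZ y y_int.
have d_neq0 : d%:Z != 0 by rewrite -lt0n.
have [r rE] : exists r : nat, (t %% d%:Z)%Z = r.
  by exists `|(t %% d%:Z)%Z|%N; rewrite gez0_abs // modz_ge0.
have r_ltd : (r < d)%N by rewrite -ltz_nat -rE ltz_pmod.
have tr_r : trace R (y + x *~ - (t %/ d%:Z)%Z) = r%:R.
  rewrite traceD traceMz tE xd -[r%:R]/(r%:~R) -rE.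
  rewrite {1}(divz_eq t d%:Z) mulrNz rmorphD /= intrM -[d%:R *~ _]mulrzl.
  by rewrite addrAC subrr add0r.
have r0 : r = 0%N.
  apply/eqP; rewrite -leqn0 leqNgt; apply/negP => r_gt0.
  suff /d_min : P r by rewrite leqNgt r_ltd.
  apply/asboolP; split=> //; exists (y + x *~ - (t %/ d%:Z)%Z); split=> //.
  by apply: integral_add => //; apply: ring_of_integersMz.
exists (t %/ d%:Z)%Z.
by rewrite tE {1}(divz_eq t d%:Z) rE r0 addr0 mulrC.
Qed.

Theorem mainTheorem3 (R : realType) (K : fieldExtType rat) (n : nat)
    (degK : \dim {:K} = n)
    (discK : forall p : nat, prime p -> (p %| n)%N ->
       ~ (((p ^ 2)%N%:Z %| discriminant R K)%Z)) :
  forall m : int,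
    exists x : K, ring_of_integers K x /\ trace R x = m%:~R.
Proof.
suff [x [x_int x1]] : exists x : K, ring_of_integers K x /\ trace R x = 1.
  by move=> m; exists (x *~ m); rewrite traceMz x1; split=> //;
    apply: ring_of_integersMz.
have n_gt0 : (0 < n)%N by rewrite -degK adim_gt0.
(* In degree 1 the element 1 has trace 1; in higher degree [n] has a prime divisor, to which [discK]
   applies. *)
have [n_le1|n_gt1] := leqP n 1.
  exists 1; split; first exact: (ring_of_integers_int K 1).
  by rewrite trace1 degK; case: n n_gt0 n_le1 {degK discK} => [|[]].
(* Otherwise the square of [pdiv n] would divide it. *)
have disc_neq0 : discriminant R K != 0.
  apply/eqP => disc0; have := discK (pdiv n) (pdiv_prime n_gt1) (pdiv_dvd n).
  by rewrite disc0 dvdz0.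
have [a [a_basis dE]] := discriminant_neq0_basis disc_neq0.
have trZ x : ring_of_integers K x -> exists t : int, trace R x = t%:~R.
  by apply: trace_int a_basis _; rewrite -dE intr_eq0.
have [d [x [d_gt0 x_int xd d_trace]]] := trace_generator trZ.
(* If [d] is 1, then [x] is the element sought; otherwise a prime factor of [d] contradicts
   [discK]. *)
have [d_le1|d_gt1] := leqP d 1.
  by exists x; split=> //; rewrite xd; case: d d_gt0 d_le1 {xd d_trace} => [|[]].
have [p p_prime /dvdnP [d' dE']] : exists2 p, prime p & (p %| d)%N.
  by exists (pdiv d); [exact: pdiv_prime|exact: pdiv_dvd].
have p_dvd_n : (p %| n)%N.
  have [t] := d_trace 1 (ring_of_integers_int K 1).
  rewrite trace1 degK -[n%:R]/(n%:~R) => /intr_inj nE.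
  suff : (p%:Z %| n%:Z)%Z by rewrite dvdzE.
  by rewrite nE dE' PoszM dvdz_mulr // dvdz_mull.
case: (discK p p_prime p_dvd_n).
apply: dvdz_trans (dvdz_discriminant (p := p) disc_neq0 _).
  by rewrite degK -(subnK n_gt1) exprD dvdz_mull.
(* Every trace is a multiple of [d], which is [d' * p]; the cofactor [d'] goes into the quotient. *)
move=> y /d_trace [t ->]; exists (d'%:Z * t).
by rewrite dE' PoszM [d'%:Z * _]mulrC mulrA.
Qed.
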